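(* Consider the stochastic Poisson system in $\mathbb{R}^d$ $$dy(t)=B(y(t))\Big(\nabla H_0(y(t))\,dt+\sum_{r=1}^m\nabla H_r(y(t))\circ dW_r(t)\Big),$$ with quadratic Hamiltonian functions $H_i(y)=\frac12y^\top S_iy$, $i=0,\dots,m$, where the $S_i\in\mathbb{R}^{d\times d}$ are constant symmetric matrices. Suppose that the structure matrix is constant, $B(y)\equiv B$, and that $\nabla H_i(y)^\top B\nabla H_j(y)=0$ for all $y\in\mathbb{R}^d$ and all $i,j\in\{0,\dots,m\}$. Then the diagonal implicit Runge-Kutta methods preserve the quadratic Hamiltonian functions: every numerical solution $\{y_k\}$ produced by a diagonal implicit Runge-Kutta method satisfies $H_i(y_{k+1})=H_i(y_k)$ for all $k$ and all $i=0,\dots,m$, almost surely.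
   Context: $B\in\mathbb{R}^{d\times d}$ is a constant skew-symmetric matrix; $W=(W_1,\dots,W_m)$ is an $m$-dimensional standard Wiener process; $\circ$ is the Stratonovich product. Diagonal implicit Runge-Kutta method with $s$ stages: given real weights $b_i^l$ ($i=1,\dots,s$, $l=0,\dots,m$) with $\sum_{i=1}^s b_i^l=1$ for each $l$, set $a_{ij}^l=b_j^l$ if $i>j$, $a_{ii}^l=\frac12 b_i^l$, $a_{ij}^l=0$ if $i<j$. With $f_l(y)=B\nabla H_l(y)$, time step $h>0$ and increments $J_k^r=W_r(t_{k+1})-W_r(t_k)$, the step $y_k\mapsto y_{k+1}$ is $$Y_i=y_k+h\sum_{j=1}^sa_{ij}^0f_0(Y_j)+\sum_{r=1}^m\sum_{j=1}^sa_{ij}^rf_r(Y_j)J_k^r,\quad i=1,\dots,s,$$ $$y_{k+1}=y_k+h\sum_{i=1}^sb_i^0f_0(Y_i)+\sum_{r=1}^m\sum_{i=1}^sb_i^rf_r(Y_i)J_k^r.$$ A numerical solution is any sequence $\{y_k\}$, with stages $Y_i$ at each step, satisfying these equations (pathwise). *)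

(* Defs.v *)
From HB Require Import structures.
From mathcomp Require Export all_boot all_order all_algebra.
From mathcomp Require Export all_classical all_reals all_analysis.
Export numFieldNormedType.Exports.

Set Implicit Arguments.
Unset Strict Implicit.
Unset Printing Implicit Defensive.

Import Order.TTheory GRing.Theory Num.Theory.

Local Open Scope classical_set_scope.
Local Open Scope ring_scope.

Section wiener_process.
Context (d : measure_display) (T : measurableType d) (R : realType).
Variable P : probability T R.

Definition mutually_independent (I : finType) (X : I -> T -> R) : Prop :=
  forall (J : {set I}) (A : I -> set R), (forall i, measurable (A i)) ->
    P (\bigcap_(i in [set` J]) (X i @^-1` A i)) =
    (\prod_(i in J) P (X i @^-1` A i))%E.

Definition increment (X : R -> {RV P >-> R}) (t u : R) (w : T) : R :=
  X u w - X t w.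

(* Only the values [W r t] with [0 <= t] matter.  The independence clause covers
   at once the independence of the components and that of the increments over
   successive time intervals.  The second parameter of [normal_prob] is the
   standard deviation. *)
Definition standard_wiener (m : nat) (W : 'I_m -> R -> {RV P >-> R}) : Prop :=
  [/\ {ae P, forall w, forall r, W r 0 w = 0},
      (forall r (t u : R), 0 <= t -> t < u -> forall A : set R, measurable A ->
         pushforward P (increment (W r) t u) A =
         normal_prob 0 (Num.sqrt (u - t)) A),
      (forall (n : nat) (t : nat -> R), 0 <= t 0%N ->
         {homo t : k l / (k <= l)%N >-> k <= l} ->
         mutually_independent
           (fun p : 'I_m * 'I_n => increment (W p.1) (t p.2) (t p.2.+1))) &
      {ae P, forall w, forall r,
         {within `[0, +oo[, continuous (fun t : R => W r t w)}}].

End wiener_process.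

Section poisson_system.
Context (R : realType) (d : nat).

Definition gradient (H : 'cV[R]_d -> R) (y : 'cV[R]_d) : 'cV[R]_d :=
  \col_i 'D_(delta_mx i 0) H y.

Definition quadratic_hamiltonian (S : 'M[R]_d) (y : 'cV[R]_d) : R :=
  2^-1 * (y^T *m S *m y) 0 0.

Definition poisson_field (B : 'cV[R]_d -> 'M[R]_d) (H : 'cV[R]_d -> R)
    (y : 'cV[R]_d) : 'cV[R]_d :=
  B y *m gradient H y.

End poisson_system.

Section diagonal_implicit_runge_kutta.
Context (R : realType) (d m s : nat).

(* Index [ord0] refers to the drift and [lift ord0 r], with [r : 'I_m], to the
   r-th noise. *)
Definition dirk_a (b : 'I_m.+1 -> 'I_s -> R) (l : 'I_m.+1) (i j : 'I_s) : R :=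
  if (j < i)%N then b l j else if i == j then b l i / 2 else 0.

Definition dirk_step (b : 'I_m.+1 -> 'I_s -> R)
    (f : 'I_m.+1 -> 'cV[R]_d -> 'cV[R]_d) (h : R) (J : 'I_m -> R)
    (y : 'cV[R]_d) (Y : 'I_s -> 'cV[R]_d) (y' : 'cV[R]_d) : Prop :=
  (forall i : 'I_s,
     Y i = y + h *: (\sum_(j < s) dirk_a b ord0 i j *: f ord0 (Y j))
           + \sum_(r < m) \sum_(j < s)
               J r *: (dirk_a b (lift ord0 r) i j *: f (lift ord0 r) (Y j))) /\
  y' = y + h *: (\sum_(i < s) b ord0 i *: f ord0 (Y i))
       + \sum_(r < m) \sum_(i < s)
           J r *: (b (lift ord0 r) i *: f (lift ord0 r) (Y i)).

(* The equations are implicit and need not be uniquely solvable: a numerical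
   solution is any random sequence satisfying them along almost every path on
   the uniform grid [t0 + k * h]. *)
Definition dirk_solution (dT : measure_display) (T : measurableType dT)
    (P : probability T R) (b : 'I_m.+1 -> 'I_s -> R)
    (f : 'I_m.+1 -> 'cV[R]_d -> 'cV[R]_d) (t0 h : R)
    (W : 'I_m -> R -> {RV P >-> R}) (y : nat -> T -> 'cV[R]_d) : Prop :=
  {ae P, forall w, forall k : nat, exists Y : 'I_s -> 'cV[R]_d,
     dirk_step b f h
       (fun r => increment (W r) (t0 + k%:R * h) (t0 + k.+1%:R * h) w)
       (y k w) Y (y k.+1 w)}.

End diagonal_implicit_runge_kutta.

(* Main.v *)
(* Adding the contribution of one stage at a time to [y_k], the coefficients
   [a_ij] make each stage value [Y_i] the midpoint of two consecutive partial
   results.  For a quadratic [H] with symmetric matrix [S], the increment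
   [H (x + v) - H x] equals [(x + v / 2)^T S v].  Hence the change of [H] at
   stage [i] is a combination of the values [grad H^T B grad H_l] at [Y_i], which
   vanish by hypothesis. *)
Require Import Defs.
From mathcomp Require Import ring.

Set Implicit Arguments.
Unset Strict Implicit.
Unset Printing Implicit Defensive.

Import Order.TTheory GRing.Theory Num.Theory.

Local Open Scope classical_set_scope.
Local Open Scope ring_scope.

(** Both sides are 1 x 1 matrices, hence equal to their own transposes. *)
Lemma symmetric_form_sym (R : realType) (d : nat) (S : 'M[R]_d)
    (S_sym : S^T = S) (x y : 'cV[R]_d) : x^T *m S *m y = y^T *m S *m x.
Proof.
have trE (M : 'M[R]_1) : M^T = M by apply/matrixP => i j; rewrite mxE !ord1.
by rewrite -[LHS]trE !trmx_mul trmxK S_sym mulmxA.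
Qed.

Lemma quadratic_hamiltonianD (R : realType) (d : nat) (S : 'M[R]_d)
    (S_sym : S^T = S) (x y : 'cV[R]_d) :
  quadratic_hamiltonian S (x + y) =
  quadratic_hamiltonian S x + (y^T *m S *m x) 0 0 + quadratic_hamiltonian S y.
Proof.
rewrite /quadratic_hamiltonian [_^T]linearD /= !mulmxDl !mulmxDr.
by rewrite (symmetric_form_sym S_sym x y) !mxE; field.
Qed.

Lemma quadratic_hamiltonianZ (R : realType) (d : nat) (S : 'M[R]_d) (a : R)
    (x : 'cV[R]_d) :
  quadratic_hamiltonian S (a *: x) = a ^+ 2 * quadratic_hamiltonian S x.
Proof.
rewrite /quadratic_hamiltonian [_^T]linearZ /= -!scalemxAl -scalemxAr !mxE; ring.
Qed.

(** The second-order expansion of a quadratic form is exact: its linear term in [v] and half of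
    [v^T S v] combine into one evaluation at the midpoint. *)
Lemma quadratic_hamiltonian_midpoint (R : realType) (d : nat) (S : 'M[R]_d)
    (S_sym : S^T = S) (x v : 'cV[R]_d) :
  quadratic_hamiltonian S (x + v) - quadratic_hamiltonian S x =
  ((x + 2^-1 *: v)^T *m S *m v) 0 0.
Proof.
rewrite quadratic_hamiltonianD // (symmetric_form_sym S_sym v x).
have -> : (x + 2^-1 *: v)^T = x^T + 2^-1 *: v^T by rewrite linearD linearZ.
rewrite !mulmxDl -!scalemxAl.
by rewrite /quadratic_hamiltonian !mxE; ring.
Qed.

Lemma derive_quadratic_hamiltonian (R : realType) (d : nat) (S : 'M[R]_d)
    (S_sym : S^T = S) (v y : 'cV[R]_d) :
  'D_v (quadratic_hamiltonian S) y = (v^T *m S *m y) 0 0.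
Proof.
apply: cvg_lim; first exact: norm_hausdorff.
set l := (_ : 'M[R]_1) 0 0.
(* For [t != 0] this affine function of [t] is exactly the difference quotient along [v]. *)
pose q (t : R) : R := l + t * quadratic_hamiltonian S v.
have q0 : q t @[t --> 0^'] --> l.
  rewrite -[X in _ --> X]addr0 -[X in _ + X](mul0r (quadratic_hamiltonian S v)).
  apply: cvgD; first exact: cvg_cst.
  by apply: cvgMr_tmp; exact: cvg_within.
apply: cvg_trans q0; apply: near_eq_cvg.
near=> t.
have t0 : t != 0 by near: t; exact: nbhs_dnbhs_neq.
rewrite /q /= [t *: v + y]addrC quadratic_hamiltonianD // quadratic_hamiltonianZ.
rewrite [(t *: v)^T]linearZ /= -!scalemxAl mxE -/l /GRing.scale /=.
by field.
Unshelve. all: by end_near.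
Qed.

Lemma gradient_quadratic_hamiltonian (R : realType) (d : nat) (S : 'M[R]_d)
    (S_sym : S^T = S) (y : 'cV[R]_d) :
  gradient (quadratic_hamiltonian S) y = S *m y.
Proof.
apply/colP => i; rewrite mxE derive_quadratic_hamiltonian //.
by rewrite -mulmxA trmx_delta -rowE mxE.
Qed.

(* [J] lists the step size followed by the noise increments. *)
Definition stage_increment (R : realType) (d m s : nat)
    (b : 'I_m.+1 -> 'I_s -> R) (f : 'I_m.+1 -> 'cV[R]_d -> 'cV[R]_d)
    (J : 'I_m.+1 -> R) (Y : 'I_s -> 'cV[R]_d) (j : 'I_s) : 'cV[R]_d :=
  \sum_(l < m.+1) (J l * b l j) *: f l (Y j).

(** The bound [n] is a natural number, so that [n = 0] gives the start of the step and [n = s] its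
    end. *)
Definition partial_step (R : realType) (d s : nat) (y : 'cV[R]_d)
    (F : 'I_s -> 'cV[R]_d) (n : nat) : 'cV[R]_d :=
  y + \sum_(j < s | (j < n)%N) F j.

Lemma partial_stepS (R : realType) (d s : nat) (y : 'cV[R]_d)
    (F : 'I_s -> 'cV[R]_d) (i : 'I_s) :
  partial_step y F i.+1 = partial_step y F i + F i.
Proof.
rewrite /partial_step (bigD1 i) //= -addrA [F i + _]addrC; congr (_ + (_ + _)).
by apply: eq_bigl => j; rewrite ltnS ltn_neqAle andbC.
Qed.

Lemma partial_step_full (R : realType) (d s : nat) (y : 'cV[R]_d)
    (F : 'I_s -> 'cV[R]_d) : partial_step y F s = y + \sum_(j < s) F j.
Proof. by congr (_ + _); apply: eq_bigl => j; rewrite ltn_ord. Qed.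

(** Drift and noise are merged into one sum, regrouped by stage. The coefficients [c] are arbitrary
    because they stand for a row of [dirk_a] in the stage equations and for [b] in the final
    update. *)
Lemma dirk_increments_sum (R : realType) (d m s : nat)
    (c : 'I_m.+1 -> 'I_s -> R) (g : 'I_m.+1 -> 'I_s -> 'cV[R]_d)
    (J : 'I_m.+1 -> R) :
  J ord0 *: (\sum_(j < s) c ord0 j *: g ord0 j) +
  \sum_(r < m) \sum_(j < s)
     J (lift ord0 r) *: (c (lift ord0 r) j *: g (lift ord0 r) j) =
  \sum_(j < s) \sum_(l < m.+1) (J l * c l j) *: g l j.
Proof.
rewrite [RHS]exchange_big big_ord_recl /= scaler_sumr; congr (_ + _).
  by apply: eq_bigr => j _; rewrite scalerA.
by apply: eq_bigr => r _; apply: eq_bigr => j _; rewrite scalerA.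
Qed.

(* The stage values are the midpoints of consecutive partial steps, so that one
   step is a composition of [s] implicit midpoint steps. *)
Lemma dirk_step_midpoints (R : realType) (d m s : nat)
    (b : 'I_m.+1 -> 'I_s -> R) (f : 'I_m.+1 -> 'cV[R]_d -> 'cV[R]_d) (h : R)
    (J : 'I_m -> R) (y : 'cV[R]_d) (Y : 'I_s -> 'cV[R]_d) (y' : 'cV[R]_d)
    (step : dirk_step b f h J y Y y') :
  exists2 J' : 'I_m.+1 -> R,
    forall i, Y i = partial_step y (stage_increment b f J' Y) i +
                    2^-1 *: stage_increment b f J' Y i &
    y' = partial_step y (stage_increment b f J' Y) s.
Proof.
pose J' l := if unlift ord0 l is Some r then J r else h.
have J'0 : J' ord0 = h by rewrite /J' unlift_none.
have J'S r : J' (lift ord0 r) = J r by rewrite /J' liftK.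
case: step => stages final.
exists J' => [i|].
  rewrite stages -addrA -J'0; under [X in _ + (_ + X)]eq_bigr do
    under eq_bigr do rewrite -J'S.
  rewrite (dirk_increments_sum (fun l => dirk_a b l i) (fun l j => f l (Y j))).
  rewrite /partial_step -addrA; congr (_ + _).
  (* Stages before [i] enter with full weight, stage [i] itself with half weight, later ones not at
     all. *)
  rewrite (bigID (fun j : 'I_s => (j < i)%N)) /=; congr (_ + _).
    apply: eq_bigr => j ji; apply: eq_bigr => l _.
    by rewrite /dirk_a ji.
  rewrite (bigD1 i) ?ltnn //= [X in _ + X]big1 ?addr0 => [|j /andP[/negbTE ji ij]].
    rewrite scaler_sumr; apply: eq_bigr => l _.
    by rewrite /dirk_a ltnn eqxx scalerA; congr (_ *: _); ring.
  apply: big1 => l _.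
  by rewrite /dirk_a ji eq_sym (negbTE ij) mulr0 scale0r.
rewrite partial_step_full final -addrA -J'0.
under [X in _ + (_ + X)]eq_bigr do under eq_bigr do rewrite -J'S.
by rewrite (dirk_increments_sum b (fun l j => f l (Y j))).
Qed.

Lemma dirk_step_quadratic_invariant (R : realType) (d m s : nat)
    (b : 'I_m.+1 -> 'I_s -> R) (f : 'I_m.+1 -> 'cV[R]_d -> 'cV[R]_d) (h : R)
    (J : 'I_m -> R) (y : 'cV[R]_d) (Y : 'I_s -> 'cV[R]_d) (y' : 'cV[R]_d)
    (S : 'M[R]_d) (S_sym : S^T = S)
    (f_orth : forall l x, x^T *m S *m f l x = 0) :
  dirk_step b f h J y Y y' ->
  quadratic_hamiltonian S y' = quadratic_hamiltonian S y.
Proof.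
case/dirk_step_midpoints => J' mid ->.
(* Induction on the number of stages added; the bound [n <= s] makes each new index a genuine
   stage. *)
suff inv n : (n <= s)%N ->
    quadratic_hamiltonian S (partial_step y (stage_increment b f J' Y) n) =
    quadratic_hamiltonian S y by exact: inv.
elim: n => [_|n IHn n_lt_s].
  by rewrite /partial_step big_pred0_eq addr0.
rewrite -{}IHn 1?ltnW //; apply/eqP; rewrite -subr_eq0; apply/eqP.
rewrite (partial_stepS _ _ (Ordinal n_lt_s)) quadratic_hamiltonian_midpoint //.
(* The midpoint is the stage value at which every field in the increment is evaluated, so [f_orth]
   kills each term. *)
rewrite -mid mulmx_sumr big1 ?mxE // => l _.
by rewrite -scalemxAr f_orth scaler0.
Qed.

Theorem theorem4p3 (R : realType) (dT : measure_display)
    (T : measurableType dT) (P : probability T R) (d m s : nat)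
    (W : 'I_m -> R -> {RV P >-> R}) (W_wiener : standard_wiener W)
    (By : 'cV[R]_d -> 'M[R]_d) (B : 'M[R]_d)
    (B_skew : B^T = - B) (By_const : forall y, By y = B)
    (S : 'I_m.+1 -> 'M[R]_d) (S_sym : forall l, (S l)^T = S l)
    (H : 'I_m.+1 -> 'cV[R]_d -> R)
    (H_quadratic : forall l, H l = quadratic_hamiltonian (S l))
    (H_involution : forall (y : 'cV[R]_d) (i j : 'I_m.+1),
       (gradient (H i) y)^T *m B *m gradient (H j) y = 0)
    (b : 'I_m.+1 -> 'I_s -> R) (b_sum : forall l, \sum_(i < s) b l i = 1)
    (t0 h : R) (t0_ge0 : 0 <= t0) (h_gt0 : 0 < h)
    (y : nat -> T -> 'cV[R]_d)
    (y_solution :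
       dirk_solution b (fun l => poisson_field By (H l)) t0 h W y) :
  {ae P, forall w, forall (k : nat) (i : 'I_m.+1),
     H i (y k.+1 w) = H i (y k w)}.
Proof.
(* The argument is pathwise: each path along which the scheme holds conserves every [H i] at all
   steps. *)
apply: filterS y_solution => w sol k i.
have [Y step] := sol k.
rewrite H_quadratic.
apply: dirk_step_quadratic_invariant (S_sym i) _ step => l x.
rewrite /poisson_field By_const mulmxA.
have := H_involution x i l.
(* Only the left gradient is computed, as [S i *m x]; the right one stays inside the field. *)
by rewrite {1}H_quadratic gradient_quadratic_hamiltonian // trmx_mul S_sym.
Qed.
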